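(* Let $A,B\in\mathbb C^{d\times d}$ define regular boundary conditions. Then the following statements are equivalent: (a) The boundary conditions defined by $A,B$ are quasi-sectorial. (b) For fixed $\varepsilon>0$, the function $$\mathbb C\setminus\bigcup_{j=1}^{l}B_\varepsilon(p_j)\to\mathbb C^{d\times d},\qquad k\mapsto\mathfrak S(k,A,B),$$ where $p_1,\dots,p_l$ are the non-removable poles of $\mathfrak S(\cdot,A,B)$, is uniformly bounded.
   Context: Let $d\in\mathbb N$. Matrices $A,B\in\mathbb C^{d\times d}$ are said to define regular boundary conditions if $\mathrm{Rank}(A\ B)=d$ and $\det(A+\lambda B)\neq0$ for some $\lambda\in\mathbb C$. In this case the Cayley transform $$\mathfrak S(k,A,B):=-(A+ikB)^{-1}(A-ikB)$$ is defined for all but finitely many $k\in\mathbb C$ and is a matrix-valued rational function of $k$; it is understood to be extended holomorphically to its removable singularities. $B_\varepsilon(p)$ is the ball of radius $\varepsilon$ around $p$. In (b), $\varepsilon>0$ is an arbitrary fixed number. For regular boundary conditions there exist (quasi-Weierstrass normal form) $0\le m\le d$, invertible $F,G\in\mathbb C^{d\times d}$, a matrix $L\in\mathbb C^{m\times m}$ and a nilpotent matrix $N_B\in\mathbb C^{(d-m)\times(d-m)}$ with $$A=F\begin{bmatrix}L&0\\0&\mathds 1_{\mathbb C^{d-m}}\end{bmatrix}G,\qquad B=F\begin{bmatrix}\mathds 1_{\mathbb C^{m}}&0\\0&N_B\end{bmatrix}G .$$ Here $\mathds 1$ denotes the identity. The boundary conditions are called quasi-sectorial if they are regular and $N_B=0$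 in this normal form (the case $m=d$, in which the second block is absent, is included). *)

(* Defs.v *)
From HB Require Import structures.
From mathcomp Require Import all_boot all_order all_algebra.
From mathcomp Require Import complex.
From mathcomp Require Import all_classical all_reals all_analysis.

Set Implicit Arguments.
Unset Strict Implicit.
Unset Printing Implicit Defensive.

Import Order.TTheory GRing.Theory Num.Theory numFieldNormedType.Exports.

Local Open Scope classical_set_scope.
Local Open Scope ring_scope.

(* R[i] packed as a numClosedFieldType: MathComp-Analysis attaches its topology
   and its normed module structure to the sorts of the number structures, and
   does not infer them on the bare type R[i]. *)
Definition Cplx (R : realType) : numClosedFieldType := R[i].

Section BoundaryConditions.
Context {R : realType} {d : nat}.
Local Notation C := (Cplx R).
Implicit Types (A B F G : 'M[C]_d) (k p : C).

Definition regular_bc A B : Prop :=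
  \rank (row_mx A B) = d /\ exists lambda : C, \det (A + lambda *: B) != 0.

(* Meaningful only where A + ikB is invertible: invmx M is M itself when M is
   singular. *)
Definition cayley_formula A B k : 'M[C]_d :=
  - (invmx (A + ('i * k) *: B) *m (A - ('i * k) *: B)).

(* S is a holomorphic function near p (complex differentiable on a
   neighbourhood of p) which extends the Cayley transform through p. *)
Definition cayley_extension A B p (S : C -> 'M[C]_d) : Prop :=
  (\forall k \near p, derivable S k 1) /\
  (\forall k \near p^', S k = cayley_formula A B k).

Definition cayley_singularities A B : set C :=
  [set p | A + ('i * p) *: B \notin unitmx].

Definition cayley_removable A B : set C :=
  [set p | exists S, cayley_extension A B p S].

(* The poles that are not removable. *)
Definition cayley_poles A B : set C :=
  cayley_singularities A B `\` cayley_removable A B.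

(* The value at a removable singularity does not depend on the extension chosen
   by xget, by continuity; the value at a pole is junk. *)
Definition cayley A B k : 'M[C]_d :=
  if A + ('i * k) *: B \in unitmx then cayley_formula A B k
  else xget (fun=> 0) [set S | cayley_extension A B k S] k.

Definition quasi_weierstrass A B (m : nat) (hm : (m <= d)%N) F G
    (L : 'M[C]_m) (N : 'M[C]_(d - m)) : Prop :=
  let cast (M : 'M[C]_(m + (d - m))) : 'M[C]_d :=
    castmx (subnKC hm, subnKC hm) M in
  [/\ F \in unitmx, G \in unitmx, exists q : nat, N ^+ q = 0,
      A = F *m cast (block_mx L 0 0 1%:M) *m G &
      B = F *m cast (block_mx 1%:M 0 0 N) *m G].

(* The normal form is not unique, but N is determined up to similarity, so the
   condition N = 0 does not depend on the normal form. *)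
Definition quasi_sectorial A B : Prop :=
  regular_bc A B /\
  exists (m : nat) (hm : (m <= d)%N) F G (L : 'M[C]_m) (N : 'M[C]_(d - m)),
    quasi_weierstrass A B hm F G L N /\ N = 0.

End BoundaryConditions.

(* Main.v *)
Require Import Defs.
From HB Require Import structures.
From mathcomp Require Import all_boot all_order all_algebra.
From mathcomp Require Import complex.
From mathcomp Require Import all_classical all_reals all_analysis.
Import Order.TTheory GRing.Theory Num.Theory numFieldNormedType.Exports.

Local Open Scope classical_set_scope.
Local Open Scope ring_scope.

(** Write z = ik, so that S(k) = -(A + zB)^-1 (A - zB).

    From boundedness to the normal form: choose l with W = A + lB invertible
    and put T = W^-1 B. The whole pencil is then A + zB = W (1 + (z - l) T), and
    the nilpotent block of the normal form vanishes exactly when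
    ker T^2 = ker T. If T^2 V = 0, the geometric series for
    (1 + (z - l) T)^-1 V stops after two terms and gives S(k) V = -V + 2z TV
    ([cayley_formula_ker_sqr]). The poles all lie among the finitely many zeros
    of det (A + ikB), so boundedness may be used for arbitrarily large k and
    forces TV = 0 ([ker_sqr_of_bounded]). A matrix with ker T^2 = ker T is
    similar to diag (K, 0) with K invertible ([index_one_block_form]), and
    this is the normal form with L = K^-1 - l
    ([quasi_sectorial_of_index_one]).

    From the normal form to boundedness: with N = iL and q = det (k - N) the
    normal form gives q S = G^-1 diag (q + 2 adj (k - N) N, -q) G, so S is a
    matrix of polynomials of degree at most deg q, divided by q
    ([quasi_sectorial_rational]). Cancelling all the common zeros
    ([cancel_common_roots]) leaves a quotient P' / q' in which every zero of q'
    is a genuine pole: a continuous extension through a zero r of q' would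
    satisfy S(r) q'(r) = P'(r), hence P'(r) = 0. The same identity shows that
    the extended transform is P' / q' at the removable singularities
    ([cayley_off_poles]); no extension has to be constructed. It remains to
    bound a quotient of polynomials with deg P' <= deg q' away from
    the zeros of q', which is done by splitting off one zero at a time
    ([ratio_bounded_off_roots]). *)

Set Implicit Arguments.
Unset Strict Implicit.

(** * Quotients of polynomials *)

(** Brings a matrix of fractions P / q to a form in which every zero of the
    denominator is a pole of some entry, without enlarging the degree of the
    numerators past that of the denominator. One common linear factor is
    removed at a time, by induction on the degree of q. *)
Lemma cancel_common_roots (F : fieldType) m n (q : {poly F})
    (P : 'M[{poly F}]_(m, n)) :
  q != 0 -> (forall i j, size (P i j) <= size q)%N ->
  exists (g q' : {poly F}) (P' : 'M[{poly F}]_(m, n)),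
    [/\ q = g * q', forall i j, P i j = g * P' i j,
        forall i j, (size (P' i j) <= size q')%N &
        forall r, (forall i j, (P' i j).[r] = 0) -> q'.[r] != 0].
Proof.
have [s] := ubnP (size q); elim: s q P => // s IHs q P ltqs q0 lePq.
case: (pselect (exists2 r, forall i j, (P i j).[r] = 0 & q.[r] = 0)); last first.
  move=> noroot; exists 1, q, P; split=> // [|i j|r Pr]; rewrite ?mul1r //.
  by apply/eqP => qr; apply: noroot; exists r.
move=> [r Pr /eqP/factor_theorem [q1 qE]].
have Pdiv i j : exists p1, P i j = p1 * ('X - r%:P).
  by have /eqP/factor_theorem [p1 ->] := Pr i j; exists p1.
pose P1 := \matrix_(i, j) xget 0 [set p1 | P i j = p1 * ('X - r%:P)].
have PE i j : P i j = P1 i j * ('X - r%:P).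
  by have [p1 p1E] := Pdiv i j; rewrite mxE; case: xgetP => // /(_ p1).
have size_div (p : {poly F}) :
    size (p * ('X - r%:P)) = if p == 0 then 0%N else (size p).+1.
  by case: eqVneq => [->|p0]; rewrite ?mul0r ?size_poly0 //
    size_Mmonic ?monicXsubC // size_XsubC addn2.
have q1_0 : q1 != 0 by apply: contraNneq q0 => q10; rewrite qE q10 mul0r.
have szq : size q = (size q1).+1 by rewrite qE size_div (negPf q1_0).
have leP1 i j : (size (P1 i j) <= size q1)%N.
  have := lePq i j; rewrite szq PE size_div.
  by case: eqVneq => [->|]; rewrite ?size_poly0.
have [|g [q' [P' [q1E P1E leP' noroot]]]] := IHs q1 P1 _ q1_0 leP1.
  by rewrite -ltnS -szq.
exists (('X - r%:P) * g), q', P'; split=> // [|i j].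
  by rewrite qE q1E mulrC mulrA.
by rewrite PE P1E mulrC mulrA.
Qed.

(** Dividing P by the linear factor of one zero r writes P as P1 (X - r) + c.
    The first term loses the factor and is bounded by induction; in the second,
    c over the remaining product is bounded by induction and 1 / (k - r) by
    1 / eps. *)
Lemma ratio_bounded_off_roots (K : numFieldType) (eps : K) (rs : seq K)
    (P : {poly K}) :
  0 < eps -> (size P <= (size rs).+1)%N ->
  exists2 c : K, 0 <= c & forall k, (forall r, r \in rs -> eps <= `|k - r|) ->
    `|P.[k] / (\prod_(r <- rs) ('X - r%:P)).[k]| <= c.
Proof.
move=> eps0; elim: rs P => [|r rs IHrs] P szP.
  exists `|P`_0| => // k _; rewrite big_nil hornerC divr1.
  by have /size1_polyC -> := szP; rewrite hornerC coefC.
have [P1 PE] : exists P1, P = P1 * ('X - r%:P) + (P.[r])%:P.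
  have /factor_theorem [P1 P1E] : root (P - (P.[r])%:P) r.
    by rewrite rootE !hornerE subrr.
  by exists P1; rewrite -P1E subrK.
have szP1 : (size P1 <= (size rs).+1)%N.
  have [->|P10] := eqVneq P1 0; first by rewrite size_poly0.
  have : size (P1 * ('X - r%:P)) = (size P1).+1.
    by rewrite size_Mmonic ?monicXsubC // size_XsubC addn2.
  have -> : P1 * ('X - r%:P) = P - (P.[r])%:P by rewrite {1}PE addrK.
  move=> szE; rewrite -ltnS -szE (leq_trans (size_polyD _ _)) // geq_max szP.
  by rewrite size_polyN (leq_trans (size_polyC_leq1 _)).
have [c1 c10 P1le] := IHrs P1 szP1.
have [|c2 c20 Crle] := IHrs (P.[r])%:P.
  by rewrite (leq_trans (size_polyC_leq1 _)).
exists (c1 + c2 / eps) => [|k offk].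
  by rewrite addr_ge0 // divr_ge0 // ltW.
have offk' s : s \in rs -> eps <= `|k - s|.
  by move=> srs; apply: offk; rewrite inE srs orbT.
have epsk : eps <= `|k - r| by apply: offk; rewrite inE eqxx.
have kr0 : k - r != 0 by rewrite -normr_gt0 (lt_le_trans eps0).
rewrite big_cons hornerM !hornerE [in X in `|X|]PE !hornerE invfM mulrDl.
rewrite [X in X + _]mulrA mulfK //.
rewrite (le_trans (ler_normD _ _)) // lerD ?P1le //.
rewrite mulrCA mulrC normrM ler_pM // ?normfV; last first.
  by rewrite lef_pV2 // posrE // normr_gt0.
by have := Crle k offk'; rewrite hornerC.
Qed.

(** * Matrices with ker T^2 = ker T *)

(** Gaussian elimination T = E (1 0; 0 0) H conjugates T by E into
    (K J; 0 0), where (K J) has full row rank. Let KZ = 0 with Z the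
    cokernel of K, and let D be a right inverse of (K J). Then X = E D Z has
    TX = E (Z; 0) and T^2 X = E (KZ; 0) = 0, so the hypothesis gives TX = 0 and
    Z = 0. Thus K is invertible, and conjugating by the
    unipotent matrix (1 -K^-1 J; 0 1) removes J. *)
Lemma index_one_block_form_rank (F : fieldType) m n (T : 'M[F]_(m + n)) :
  \rank T = m ->
  (forall p (V : 'M[F]_(m + n, p)), T *m (T *m V) = 0 -> T *m V = 0) ->
  exists (V : 'M[F]_(m + n)) (K : 'M[F]_m),
    [/\ V \in unitmx, K \in unitmx & T *m V = V *m block_mx K 0 0 0].
Proof.
move=> rkT index1.
pose E := col_ebase T; pose H := row_ebase T.
have Eu : E \in unitmx := col_ebase_unit T.
have Hu : H \in unitmx := row_ebase_unit T.
pose K := ulsubmx (H *m E); pose J := ursubmx (H *m E).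
have TE : T *m E = E *m block_mx K J 0 0.
  rewrite -{1}(mulmx_ebase T) rkT pid_mx_block -/E -/H -!mulmxA; congr (_ *m _).
  by rewrite -(submxK (H *m E)) mulmx_block !mul1mx !mul0mx !addr0.
have [D KJD] : exists D, row_mx K J *m D = 1%:M.
  exists (invmx E *m (invmx H *m col_mx 1%:M 0)).
  have -> : row_mx K J = row_mx 1%:M 0 *m (H *m E).
    by rewrite -[H *m E]submxK block_mxEv mul_row_col mul1mx mul0mx addr0.
  by rewrite -!mulmxA mulKVmx // mulKVmx // mul_row_col mul1mx mul0mx addr0.
have Ku : K \in unitmx.
  pose Z := cokermx K.
  have KZ : K *m Z = 0 by exact: mulmx_coker.
  have TV : T *m (E *m (D *m Z)) = E *m col_mx Z 0.
    rewrite mulmxA TE -mulmxA; congr (_ *m _).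
    by rewrite block_mxEv mul_col_mx !mulmxA KJD mul1mx row_mx0 !mul0mx.
  have /index1 : T *m (T *m (E *m (D *m Z))) = 0.
    rewrite TV mulmxA TE -mulmxA block_mxEv mul_col_mx row_mx0 mul0mx.
    by rewrite mul_row_col KZ mulmx0 addr0 col_mx0 mulmx0.
  rewrite TV => /(congr1 (mulmx (invmx E))); rewrite mulKmx // mulmx0.
  rewrite -col_mx0 => /eq_col_mx [Z0 _].
  have := mxrank_coker K; rewrite -/Z Z0 mxrank0 => /eqP.
  by rewrite eq_sym subn_eq0 -row_full_unit /row_full eqn_leq rank_leq_col.
have VV : block_mx 1%:M (- (invmx K *m J)) 0 1%:M *m
          block_mx 1%:M (invmx K *m J) 0 1%:M = 1%:M.
  by rewrite mulmx_block !mulmx0 !mul0mx !mul1mx !mulmx1 !addr0 subrr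
             add0r -scalar_mx_block.
exists (E *m block_mx 1%:M (- (invmx K *m J)) 0 1%:M), K; split=> //.
  by rewrite unitmx_mul Eu; case/mulmx1_unit: VV.
rewrite mulmxA TE -!mulmxA; congr (_ *m _).
rewrite !mulmx_block !mulmx0 !mul0mx !mul1mx !mulmx1 !addr0 mulmxN mulKVmx //.
by rewrite addNr.
Qed.

Lemma index_one_block_form (F : fieldType) d (T : 'M[F]_d) :
  (forall p (V : 'M[F]_(d, p)), T *m (T *m V) = 0 -> T *m V = 0) ->
  exists (m n : nat) (e : (m + n)%N = d) (V : 'M[F]_d) (K : 'M[F]_m),
    [/\ V \in unitmx, K \in unitmx &
        T *m V = V *m castmx (e, e) (block_mx K 0 0 0)].
Proof.
move=> index1.
suff H m n (e : (m + n)%N = d) : \rank T = m ->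
    exists (V : 'M[F]_d) (K : 'M[F]_m), [/\ V \in unitmx, K \in unitmx &
        T *m V = V *m castmx (e, e) (block_mx K 0 0 0)].
  have [V [K HVK]] := H _ _ (subnKC (rank_leq_row T)) (erefl _).
  by exists (\rank T), (d - \rank T)%N, (subnKC (rank_leq_row T)), V, K.
by case: d / e T index1 => T index1 rkT; exact: index_one_block_form_rank.
Qed.

(** * Degrees in the normal form *)

Lemma size_mulmx_constr (F : fieldType) m n p (X : 'M[{poly F}]_(m, n))
    (Y : 'M[F]_(n, p)) s :
  (forall i j, size (X i j) <= s)%N ->
  forall i j, (size ((X *m map_mx polyC Y) i j) <= s)%N.
Proof.
move=> leX i j; rewrite mxE (leq_trans (size_sum _ _ _)) //.
apply/bigmax_leqP => l _; rewrite mxE mulrC mul_polyC.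
by rewrite (leq_trans (size_scale_leq _ _)).
Qed.

Lemma size_mulmx_constl (F : fieldType) m n p (X : 'M[F]_(m, n))
    (Y : 'M[{poly F}]_(n, p)) s :
  (forall i j, size (Y i j) <= s)%N ->
  forall i j, (size ((map_mx polyC X *m Y) i j) <= s)%N.
Proof.
move=> leY i j; rewrite mxE (leq_trans (size_sum _ _ _)) //.
apply/bigmax_leqP => l _; rewrite mxE mul_polyC.
by rewrite (leq_trans (size_scale_leq _ _)).
Qed.

Lemma size_det_leq (F : fieldType) n (X : 'M[{poly F}]_n) :
  (forall i j, size (X i j) <= 2)%N -> (size (\det X) <= n.+1)%N.
Proof.
move=> leX; rewrite (leq_trans (size_sum _ _ _)) //.
apply/bigmax_leqP => s _; rewrite size_Msign (leq_trans (size_poly_prod_leq _ _)) //.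
rewrite leq_subLR cardT size_enum_ord addnS ltnS addnn -muln2.
rewrite (leq_trans (leq_sum _ (fun i _ => leX i _))) //.
by rewrite sum_nat_const card_ord.
Qed.

Lemma size_adj_char_poly_mx (F : fieldType) n (N : 'M[F]_n) i j :
  (size ((\adj (char_poly_mx N)) i j) <= n)%N.
Proof.
rewrite mxE /cofactor size_Msign.
have := @size_det_leq F n.-1 (row' j (col' i (char_poly_mx N))).
case: n N i j => [|n] N i j; first by case: i.
apply=> i' j'; rewrite !mxE (leq_trans (size_polyD _ _)) // geq_max size_polyN.
rewrite (leq_trans (size_polyC_leq1 _)) // andbT.
by case: eqP; rewrite ?size_polyX ?size_poly0.
Qed.

(** * Continuity and matrix norms *)

Lemma continuous_horner_poly (K : numFieldType) (p : {poly K}) :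
  continuous (fun x : K => p.[x]).
Proof.
elim/poly_ind: p => [|p c IHp].
  have -> : horner (0 : {poly K}) = cst 0 by apply/funext => y; rewrite horner0.
  exact: cst_continuous.
have -> : horner (p * 'X + c%:P) = (fun y => p.[y] * y + c).
  by apply/funext => y; rewrite hornerMXaddC.
by move=> x; exact: cvgD (cvgM (IHp x) cvg_id) (cvg_cst _).
Qed.

Lemma near_horner_neq0 (K : numFieldType) (p : {poly K}) (x : K) :
  p != 0 -> \forall k \near x^', p.[k] != 0.
Proof.
have [s] := ubnP (size p); elim: s p => // s IHs p ltps p0.
have [/eqP px|px] := eqVneq p.[x] 0; last first.
  apply: nbhs_dnbhs; exact: (cvgr_neq0 _ (@continuous_horner_poly K p x)).
have [p1 pE] := factor_theorem p x px.
have p10 : p1 != 0 by apply: contraNneq p0 => p10; rewrite pE p10 mul0r.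
have : \forall k \near x^', p1.[k] != 0.
  apply: IHs => //; move: ltps.
  by rewrite pE size_Mmonic ?monicXsubC // size_XsubC addn2.
apply: filterS2 (nbhs_dnbhs_neq x) => k kx p1k.
by rewrite pE hornerM mulf_neq0 // !hornerE subr_eq0.
Qed.

Lemma mx_entry_norm_le (K : numFieldType) m n (M : 'M[K]_(m, n)) i j :
  `|M i j| <= `|M|.
Proof.
rewrite -[leRHS]/(mx_norm M) mx_normE.
rewrite (_ : `|M i j| = `|M i j|%:nng%:num) // num_le.
by apply/bigmax_geP; right; exists (i, j).
Qed.

Lemma mx_norm_le_entries (K : numFieldType) m n (M : 'M[K]_(m, n)) c :
  0 <= c -> (forall i j, `|M i j| <= c) -> `|M| <= c.
Proof.
move=> c0 Mc; rewrite -[leLHS]/(mx_norm M).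
by have [->//|/mx_norm_neq0 [ij ->]] := eqVneq (mx_norm M) 0.
Qed.

(** * Poles and bounds of a rational Cayley transform *)

Section CayleyRational.
Context {R : realType} {d : nat}.
Local Notation C := (Cplx R).
Context (A B : 'M[C]_d) (q : {poly C}) (P : 'M[{poly C}]_d).
Context (q_neq0 : q != 0).
Context (unitE : forall k, (A + ('i * k) *: B \in unitmx) = (q.[k] != 0)).
Context (cayleyE : forall k, q.[k] != 0 -> forall i j,
  cayley_formula A B k i j = (P i j).[k] / q.[k]).

(** Multiplying by the reduced denominator q' gives an identity between
    functions that are continuous at p. It holds in a punctured neighbourhood
    of p, where q does not vanish, hence at p too. *)
Lemma cayley_extension_ratio (p : C) S : cayley_extension A B p S ->
  forall (g q' : {poly C}) (P' : 'M[{poly C}]_d),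
  q = g * q' -> (forall i j, P i j = g * P' i j) ->
  forall i j, S p i j * q'.[p] = (P' i j).[p].
Proof.
move=> [derS SE] g q' P' qE PE i j.
have contS : {for p, continuous S}.
  apply: differentiable_continuous; apply/derivable1_diffP.
  exact: nbhs_singleton derS.
pose h k := S k i j * q'.[k] - (P' i j).[k].
have hp : h k @[k --> p^'] --> h p.
  apply: cvg_trans (@cvg_app _ _ _ _ h (@nbhs_dnbhs _ p)) _.
  apply: cvgB; last exact: continuous_horner_poly.
  apply: cvgM; last exact: continuous_horner_poly.
  exact: (@continuous_comp _ _ _ S (fun M : 'M[C]_d => M i j) p contS
    (@coord_continuous _ _ _ i j _)).
have h0 : h k @[k --> p^'] --> (0 : C).
  apply: cvg_near_cst.
  apply: filterS2 SE (near_horner_neq0 p q_neq0) => k SkE qk.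
  rewrite /h SkE cayleyE // PE qE !hornerM.
  move: qk; rewrite qE hornerM mulf_eq0 negb_or => /andP[gk q'k].
  by rewrite -mulf_div divff // mul1r divfK // subrr.
by apply/eqP; rewrite -subr_eq0; apply/eqP; exact: (cvg_unique _ hp h0).
Qed.

(** Two cases: a point where the pencil is invertible, and a removable
    singularity. In the second, a zero of q' would be a common zero of P' by
    [cayley_extension_ratio]. *)
Lemma cayley_off_poles (g q' : {poly C}) (P' : 'M[{poly C}]_d) :
  q = g * q' -> (forall i j, P i j = g * P' i j) ->
  (forall r, (forall i j, (P' i j).[r] = 0) -> q'.[r] != 0) ->
  forall k, ~ cayley_poles A B k ->
  q'.[k] != 0 /\ forall i j, cayley A B k i j = (P' i j).[k] / q'.[k].
Proof.
move=> qE PE noroot k npole.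
rewrite /cayley unitE; case: ifPn => [qk|qk].
  move: (qk); rewrite qE hornerM mulf_eq0 negb_or => /andP[gk q'k].
  split=> // i j; rewrite cayleyE // PE qE !hornerM.
  by rewrite -mulf_div divff // mul1r.
have [S0 S0ext] : cayley_removable A B k.
  by apply: contrapT => nrem; apply: npole; split=> //;
    rewrite /cayley_singularities /= unitE.
case: xgetP => [S _ Sext|/(_ S0)//].
have SE := cayley_extension_ratio Sext qE PE.
have q'k : q'.[k] != 0.
  apply/negP => /eqP q'k; have := noroot k.
  rewrite q'k eqxx => H; suff: false by []. apply: H => i j.
  by rewrite -SE q'k mulr0.
by split=> // i j; rewrite -SE mulfK.
Qed.

(** By contraposition of [cayley_off_poles] the zeros of q' are poles, so the
    excluded balls keep k at distance at least eps from each of them. *)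
Lemma cayley_bounded (eps : C) : 0 < eps ->
  (forall i j, size (P i j) <= size q)%N ->
  [bounded cayley A B k | k in
     ~` (\bigcup_(p in cayley_poles A B) ball p eps)].
Proof.
move=> eps0 lePq.
have [g [q' [P' [qE PE leP' noroot]]]] := cancel_common_roots q_neq0 lePq.
have off := cayley_off_poles qE PE noroot.
have q'0 : q' != 0 by apply: contraNneq q_neq0 => q'0; rewrite qE q'0 mulr0.
have [rs q'E] := closed_field_poly_normal q'.
have lc0 : lead_coef q' != 0 by rewrite lead_coef_eq0.
have szq' : size q' = (size rs).+1.
  by rewrite q'E size_scale // size_prod_XsubC.
have polers r : r \in rs -> cayley_poles A B r.
  move=> rrs; apply: contrapT => /off [+ _].
  by rewrite q'E hornerZ (rootP _) ?mulr0 ?eqxx // root_prod_XsubC.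
have bd ij : exists c : C, 0 <= c /\ forall k, (forall r, r \in rs -> eps <= `|k - r|) ->
    `|(P' ij.1 ij.2).[k] / (\prod_(r <- rs) ('X - r%:P)).[k]| <= c.
  have [|c c0 cP] := @ratio_bounded_off_roots _ _ rs (P' ij.1 ij.2) eps0.
    by rewrite -szq'.
  by exists c.
have [c cP] := choice bd.
pose M := \sum_ij (c ij / `|lead_coef q'|).
have c0 ij : 0 <= c ij / `|lead_coef q'| by rewrite divr_ge0 //; case: (cP ij).
have M0 : 0 <= M by apply: sumr_ge0.
exists M; split; first exact: ger0_real.
move=> x Mx k /= kout; rewrite (le_trans _ (ltW Mx)) //.
have offk r : r \in rs -> eps <= `|k - r|.
  move=> rrs; rewrite real_leNgt ?normr_real ?gtr0_real //.
  apply/negP => rk; apply: kout; exists r; first exact: polers.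
  by rewrite /ball /= distrC.
apply: mx_norm_le_entries => [|i j]; first exact: sumr_ge0.
have [_ ->] : q'.[k] != 0 /\ forall i j, cayley A B k i j = (P' i j).[k] / q'.[k].
  by apply: off => kpole; apply: kout; exists k => //; exact: ballxx.
rewrite /M (bigD1 (i, j)) //= -[leLHS]addr0 lerD ?sumr_ge0 //.
rewrite [in leLHS]q'E hornerZ invfM mulrCA mulrC normrM normfV.
by rewrite ler_pM2r ?invr_gt0 ?normr_gt0 //; case: (cP (i, j)) => _; exact.
Qed.

End CayleyRational.

(** * From the normal form to a bounded transform *)

(** Since L = -iN, the first blocks of A + ikB and A - ikB are i (k - N) and
    -i (k + N), so the first block of S is (k - N)^-1 (k + N). Writing
    k + N = (k - N) + 2N keeps the degree of the numerator q + 2 adj (k - N) N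
    visibly at most that of q. *)
Lemma quasi_sectorial_rational (R : realType) d (A B : 'M[Cplx R]_d) :
  quasi_sectorial A B ->
  exists (q : {poly Cplx R}) (P : 'M[{poly Cplx R}]_d),
  [/\ q != 0, (forall i j, size (P i j) <= size q)%N,
      forall k, (A + ('i * k) *: B \in unitmx) = (q.[k] != 0) &
      forall k, q.[k] != 0 ->
        forall i j, cayley_formula A B k i j = (P i j).[k] / q.[k]].
Proof.
move=> [_ [m [hm [F [G [L [N [[]]]]]]]]].
(* Generalizing over d - m allows d to be replaced by m + n, which removes the
   casts of the block matrices. *)
move: (subnKC hm) N; move: (d - m)%N => n e N {hm}.
move: A B F G; case: d / e => A' B' F G Fu Gu _ -> -> ->; rewrite !castmx_id.
pose N' := 'i *: L; pose adj := \adj (char_poly_mx N').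
pose q := char_poly N'.
pose D : 'M[{poly Cplx R}]_(m + n) :=
  block_mx (q%:M + 2%:P *: (adj *m map_mx polyC N')) 0 0 (- q%:M).
pose P := map_mx polyC (invmx G) *m D *m map_mx polyC G.
have q0 : q != 0 by rewrite monic_neq0 // char_poly_monic.
have evC m1 n1 (M : 'M[Cplx R]_(m1, n1)) k : map_mx (horner_eval k) (map_mx polyC M) = M.
  by rewrite -map_mx_comp map_mx_id // => x /=; rewrite /horner_eval hornerC.
have evX k : map_mx (horner_eval k) (char_poly_mx N') = k%:M - N'.
  by rewrite map_mxB evC map_scalar_mx /= /horner_eval hornerX.
have evq k : q.[k] = \det (k%:M - N').
  by rewrite -evX det_map_mx.
have ME k :
    F *m block_mx L 0 0 1%:M *m G + ('i * k) *: (F *m block_mx 1%:M 0 0 0 *m G)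
    = F *m block_mx ('i *: (k%:M - N')) 0 0 1%:M *m G.
  rewrite scalemxAl scalemxAr -mulmxDl -mulmxDr scale_block_mx add_block_mx.
  rewrite !scaler0 !addr0 /N' scalerBr scalerA -expr2 sqrCi scaleN1r opprK.
  by rewrite !scale_scalar_mx mulr1 addrC.
have unitE k : (F *m block_mx L 0 0 1%:M *m G +
    ('i * k) *: (F *m block_mx 1%:M 0 0 0 *m G) \in unitmx) = (q.[k] != 0).
  rewrite ME !unitmx_mul Fu Gu andbT /= unitmxE det_ublock det1 mulr1 detZ -evq.
  by rewrite unitfE mulf_eq0 expf_eq0 (negPf (neq0Ci _)) andbF.
exists q, P; split=> // [i j|k qk i j].
  apply: size_mulmx_constr; apply: size_mulmx_constl => {i j} i j.
  have szq : size q = m.+1 := size_char_poly _.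
  rewrite szq !mxE; case: (fintype.split i) => i'; rewrite !mxE;
    case: (fintype.split j) => j'.
  - rewrite !mxE (leq_trans (size_polyD _ _)) // geq_max; apply/andP; split.
      by case: eqP; rewrite ?mulr1n ?mulr0n ?size_poly0 ?szq.
    rewrite mul_polyC (leq_trans (size_scale_leq _ _)) //.
    have := @size_mulmx_constr _ _ _ _ adj N' m.+1 _ i' j'.
    by rewrite !mxE; apply=> a b; exact: leqW (size_adj_char_poly_mx _ _ _).
  - by rewrite mxE size_poly0.
  - by rewrite mxE size_poly0.
  - by rewrite !mxE size_polyN; case: eqP; rewrite ?mulr1n ?mulr0n ?size_poly0 ?szq.
rewrite /cayley_formula.
set M := _ + _.
have Mu : M \in unitmx by rewrite unitE.
have MBE : F *m block_mx L 0 0 1%:M *m G - ('i * k) *: (F *m block_mx 1%:M 0 0 0 *m G)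
    = F *m block_mx (- ('i *: (k%:M + N'))) 0 0 1%:M *m G.
  rewrite scalemxAl scalemxAr -mulmxBl -mulmxBr scale_block_mx opp_block_mx add_block_mx.
  rewrite !scaler0 oppr0 !addr0 /N' scalerDr scalerA -expr2 sqrCi scaleN1r.
  by rewrite !scale_scalar_mx mulr1 opprD opprK !subr0 addrC.
have PkE : M *m map_mx (horner_eval k) P = - q.[k] *:
  (F *m block_mx L 0 0 1%:M *m G - ('i * k) *: (F *m block_mx 1%:M 0 0 0 *m G)).
  rewrite MBE /M ME /P !map_mxM !evC -!mulmxA mulKVmx // [RHS]scalemxAr.
  congr (F *m _); rewrite !mulmxA scalemxAl; congr (_ *m G).
  have evqM r : map_mx (horner_eval k) (q%:M : 'M[{poly Cplx R}]_r) = (q.[k])%:M.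
    by rewrite map_scalar_mx.
  have evadj : (k%:M - N') *m map_mx (horner_eval k) adj = (q.[k])%:M.
    by rewrite /adj map_mx_adj evX mul_mx_adj evq.
  rewrite map_block_mx !map_mx0 mulmx_block scale_block_mx.
  rewrite !mulmx0 !mul0mx !addr0 !add0r !scaler0 mul1mx map_mxN evqM.
  congr (block_mx _ 0 0 _); last by rewrite scale_scalar_mx mulr1 raddfN.
  rewrite scaleNr scalerN opprK -scalemxAl map_mxD evqM map_mxZ map_mxM evC.
  rewrite mulmxDr -scalemxAr mulmxA evadj.
  set c := (X in X *: (_ *m N')); have {c}-> : c = 2 by exact: hornerC.
  rewrite mul_mx_scalar mul_scalar_mx.
  rewrite scalerA [_ * q.[k]]mulrC -scalerA -scalerDr scalerA mulrC.
  rewrite -scalerA scaler_nat mulr2n.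
  by rewrite addrA subrK.
have -> : (P i j).[k] = map_mx (horner_eval k) P i j by rewrite [RHS]mxE.
rewrite -[map_mx _ P](mulKmx Mu) PkE -scalemxAr scaleNr -scalerN.
by rewrite [X in X / _]mxE [RHS]mulrC mulKf.
Qed.

(** * From a bounded transform to the normal form *)

(** With W = A + lB the pencil acts on the T-invariant span of V and TV by
    A + cB : V -> W (V + (c - l) TV) and TV -> W TV, so the identity can be
    checked after multiplication by A + ikB. *)
Lemma cayley_formula_ker_sqr (R : realType) d p (A B : 'M[Cplx R]_d) (l k : Cplx R)
    (V : 'M[Cplx R]_(d, p)) :
  A + l *: B \in unitmx -> A + ('i * k) *: B \in unitmx ->
  let T := invmx (A + l *: B) *m B in
  T *m (T *m V) = 0 -> cayley_formula A B k *m V = - V + (2 * ('i * k)) *: (T *m V).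
Proof.
move=> Wu Mu T TTV; rewrite /cayley_formula.
set z := 'i * k in Mu *; set W := A + l *: B in Wu T TTV *.
have BE : B = W *m T by rewrite mulKVmx.
clearbody T.
have AE : A = W *m (1%:M - l *: T).
  by rewrite mulmxBr mulmx1 -scalemxAr -BE addrK.
have pencilE c : (A + c *: B) *m V = W *m (V + (c - l) *: (T *m V)).
  rewrite {1}AE {1}BE scalemxAr -mulmxDr -mulmxA; congr (_ *m _).
  by rewrite -addrA -scaleNr -scalerDl mulmxDl mul1mx -scalemxAl addrC
             [- l + c]addrC addrC.
have pencilTE c : (A + c *: B) *m (T *m V) = W *m (T *m V).
  rewrite {1}AE {1}BE scalemxAr -mulmxDr -mulmxA; congr (_ *m _).
  by rewrite -addrA -scaleNr -scalerDl mulmxDl mul1mx -scalemxAl TTV scaler0 addr0.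
apply: (can_inj (mulKmx Mu)).
rewrite mulNmx mulmxN !mulmxA mulmxV // mul1mx -scaleNr pencilE.
rewrite [RHS]mulmxDr mulmxN -scalemxAr pencilE pencilTE
        [_ *: (W *m _)]scalemxAr -!mulmxN -mulmxDr.
congr (_ *m _); rewrite !opprD -addrA -!scaleNr -scalerDl; congr (_ + _ *: _).
by rewrite scaleNr opprD !opprK opprB mulr_natl mulr2n addrA subrK addrC.
Qed.

(** Applying S(k) to V multiplies its size by a bounded factor only, whereas
    S(k) V = -V + 2ik TV grows linearly in k unless TV = 0. *)
Lemma ker_sqr_of_bounded (R : realType) d (A B : 'M[Cplx R]_d) (eps l : Cplx R) :
  0 < eps -> A + l *: B \in unitmx ->
  [bounded cayley A B k | k in
     ~` (\bigcup_(p in cayley_poles A B) ball p eps)] ->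
  let T := invmx (A + l *: B) *m B in
  forall p (V : 'M[Cplx R]_(d, p)), T *m (T *m V) = 0 -> T *m V = 0.
Proof.
move=> eps0 Wu /pinfty_ex_gt0 [b b0 bP] T p V TTV.
pose Q : {poly Cplx R} := \det (map_mx polyC A + ('i *: 'X) *: map_mx polyC B).
have QE k : Q.[k] = \det (A + ('i * k) *: B).
  rewrite -[LHS]/(horner_eval k _) -det_map_mx map_mxD map_mxZ /= /horner_eval !hornerE.
  by rewrite -!map_mx_comp !map_mx_id // => x /=; rewrite /horner_eval hornerC.
have Q0 : Q != 0.
  apply: contraTneq Wu => Q0; rewrite unitmxE unitfE negbK.
  have := QE (- 'i * l); rewrite Q0 horner0 mulrA mulrN -expr2 sqrCi opprK mul1r.
  by move=> <-.
have [rs Qrs] := closed_field_poly_normal Q.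
apply/matrixP => i j; rewrite [RHS]mxE; apply/eqP; apply: contraT => x0.
set x := (T *m V) i j in x0.
have nx0 : 0 < `|x| by rewrite normr_gt0.
pose c := \sum_l `|V l j|.
have c0 : 0 <= c by apply: sumr_ge0.
have rs0 : 0 <= \sum_(r <- rs) `|r| by apply: sumr_ge0.
(* Positive, so large that 2k|x| exceeds the bound b c + |V i j| on the entry of
   S(k) V + V, and at distance at least eps from every zero of Q. *)
pose k := (b * c + `|V i j|) / `|x| + \sum_(r <- rs) `|r| + eps.
have bc0 : 0 <= (b * c + `|V i j|) / `|x|.
  by rewrite divr_ge0 // addr_ge0 // mulr_ge0 // ltW.
have k0 : 0 < k by rewrite ltr_wpDl // addr_ge0.
have farr r : r \in rs -> eps <= `|r - k|.
  move=> rrs; rewrite distrC; apply: le_trans (lerB_dist _ _).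
  rewrite (gtr0_norm k0) lerBrDr /k addrC lerD2r.
  rewrite (big_rem r) //= addrCA lerDl addr_ge0 //.
  by apply: sumr_ge0.
have Qk r : Q.[r] = 0 -> r \in rs.
  rewrite {1}Qrs hornerZ => /eqP; rewrite mulf_eq0 lead_coef_eq0 (negPf Q0) /=.
  by rewrite -[_ == 0]/(root _ r) root_prod_XsubC.
have Mu : A + ('i * k) *: B \in unitmx.
  rewrite unitmxE unitfE -QE; apply/eqP => /Qk /farr.
  by rewrite subrr normr0 lt_geF.
have kout : (~` (\bigcup_(p in cayley_poles A B) ball p eps)) k.
  move=> [r [rsing _]]; rewrite /ball /= => rk.
  have : eps <= `|r - k|.
    apply: farr; apply: Qk; apply/eqP; rewrite QE.
    by move: rsing; rewrite /cayley_singularities /= unitmxE unitfE negbK.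
  by move=> /le_lt_trans /(_ rk); rewrite ltxx.
have /= := bP k kout; rewrite /cayley Mu => Sb.
have SV := cayley_formula_ker_sqr Wu Mu TTV.
have SVle : `|(cayley_formula A B k *m V) i j| <= b * c.
  rewrite mxE (le_trans (ler_norm_sum _ _ _)) // /c mulr_sumr ler_sum // => t _.
  rewrite normrM ler_wpM2r // (le_trans _ Sb) //; exact: mx_entry_norm_le.
have xE : 2 * ('i * k) * x = (cayley_formula A B k *m V) i j + V i j.
  by rewrite SV 3!mxE addrAC addNr add0r.
have : 2 * k * `|x| <= b * c + `|V i j|.
  rewrite -[2 * k]gtr0_norm ?mulr_gt0 // -normrM.
  have -> : `|2 * k * x| = `|2 * ('i * k) * x| by rewrite !normrM normCi mul1r.
  by rewrite xE (le_trans (ler_normD _ _)) // lerD2r.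
rewrite -ler_pdivlMr // lt_geF //; apply: (@le_lt_trans _ _ k).
  by rewrite /k -addrA lerDl addr_ge0 // ltW.
by rewrite mulr_natl mulr2n ltrDl.
Qed.

(** In a basis V with TV = V diag (K, 0), factoring diag (K, 1) out of
    B = WT and A = W (1 - lT) leaves diag (1, 0) and diag (K^-1 - l, 1). *)
Lemma quasi_sectorial_of_index_one (R : realType) d (A B : 'M[Cplx R]_d) (l : Cplx R) :
  regular_bc A B -> A + l *: B \in unitmx ->
  (let T := invmx (A + l *: B) *m B in
   forall p (V : 'M[Cplx R]_(d, p)), T *m (T *m V) = 0 -> T *m V = 0) ->
  quasi_sectorial A B.
Proof.
move=> reg Wu /index_one_block_form [m [n [e [V [K [Vu Ku TV]]]]]]; split=> //.
have mled : (m <= d)%N by rewrite -e leq_addr.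
have nE : n = (d - m)%N by rewrite -e addKn.
case: _ / (esym nE) in e TV *.
rewrite (eq_irrelevance e (subnKC mled)) in TV; clear reg e n nE.
pose D := castmx (subnKC mled, subnKC mled) (block_mx K 0 0 1%:M).
exists m, mled, ((A + l *: B) *m V *m D), (invmx V), (invmx K - l%:M), 0.
split=> //; rewrite /quasi_weierstrass {}/D.
(* Generalizing over d - m allows d to be replaced by m + n, which removes the
   casts of the block matrices. *)
move: (subnKC mled) TV; move: (d - m)%N => n e {mled}.
case: d / e A B V Vu Wu => A B V Vu Wu; rewrite !castmx_id => TV.
have BV : B *m V = (A + l *: B) *m V *m block_mx K 0 0 0.
  by rewrite -mulmxA -TV -mulmxA mulKVmx.
have AV : A *m V = (A + l *: B) *m V *m block_mx (1%:M - l *: K) 0 0 1%:M.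
  rewrite -[A in LHS](addrK (l *: B)) mulmxBl -scalemxAl BV scalemxAr.
  rewrite -{1}[_ *m V]mulmx1 -mulmxBr; congr (_ *m _).
  by rewrite scalar_mx_block scale_block_mx opp_block_mx add_block_mx !scaler0 !subr0.
split; rewrite ?unitmx_inv //.
- rewrite !unitmx_mul Wu Vu /= unitmxE det_ublock det1 mulr1.
  by rewrite -unitmxE.
- by exists 1%N; rewrite expr1.
- rewrite -[LHS](mulmxK Vu) AV; congr (_ *m _); rewrite -!mulmxA; congr (_ *m (_ *m _)).
  rewrite mulmx_block !mulmx0 !mul0mx !addr0 !add0r mulmx1 mulmxBr mulmxV //.
  by rewrite mul_mx_scalar.
- rewrite -[LHS](mulmxK Vu) BV; congr (_ *m _); rewrite -!mulmxA; congr (_ *m (_ *m _)).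
  by rewrite mulmx_block !mulmx0 !mul0mx !addr0 mulmx1.
Qed.

Unset Implicit Arguments.
Set Strict Implicit.

Theorem lemma3p7 (R : realType) (d : nat) (A B : 'M[Cplx R]_d) (eps : R)
    (heps : 0 < eps) (hreg : regular_bc A B) :
  quasi_sectorial A B <->
  [bounded cayley A B k | k in
     ~` (\bigcup_(p in cayley_poles A B) ball p (eps%:C)%C)].
Proof.
have eps0 : 0 < (eps%:C)%C :> Cplx R by rewrite ltcR.
split=> [/quasi_sectorial_rational [q [P [q0 lePq unitE SE]]]|bd].
  exact: (cayley_bounded q0 unitE SE eps0 lePq).
have [_ [l detl]] := hreg.
have Wu : A + l *: B \in unitmx by rewrite unitmxE unitfE.
exact: (quasi_sectorial_of_index_one hreg Wu (ker_sqr_of_bounded eps0 Wu bd)).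
Qed.
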